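(* Let $X$ and $Y$ be Banach spaces. If $X$ or $Y$ has the Radon-Nikodým property, then $\mathrm{QNA}(X,Y)$ is dense in $\mathcal{L}(X,Y)$.
   Context: Banach spaces are over $\mathbb{K}=\mathbb{R}$ or $\mathbb{C}$; $B_X$ is the closed unit ball of $X$; $\mathcal{L}(X,Y)$ is the space of bounded linear operators with the operator norm. $T\in\mathcal{L}(X,Y)$ is quasi norm attaining, $T\in\mathrm{QNA}(X,Y)$, if there is $u\in\overline{T(B_X)}$ (norm closure) with $\|u\|=\|T\|$. A Banach space has the Radon-Nikodým property (RNP) if every nonempty bounded subset of it is dentable, where a set $A$ is dentable if for every $\delta>0$ there is $a\in A$ not belonging to the closed convex hull of $A\setminus\{b:\|b-a\|<\delta\}$. *)

(* Defs.v *)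
From HB Require Import structures.
From mathcomp Require Import all_boot all_order all_algebra.
From mathcomp Require Import all_classical all_reals all_analysis.
From mathcomp Require Import complex.

Set Implicit Arguments.
Unset Strict Implicit.
Unset Printing Implicit Defensive.

Import Order.TTheory GRing.Theory Num.Theory.
Import numFieldNormedType.Exports.

Local Open Scope classical_set_scope.
Local Open Scope ring_scope.

(* The notions below are stated for a scalar field K : numFieldType and are
   meant for K = R and K = R[i] with R : realType. When K = R[i], norms take
   values in R[i]; the order of R[i] makes 0 <= z mean that z is a nonnegative
   real number, so 0 < eps quantifies over positive reals, and convex_set
   (coefficients 0 <= t <= 1 in K) is convexity with real coefficients. *)

Section Defs.
Context {K : numFieldType}.

Definition closed_unit_ball (X : normedModType K) : set X :=
  [set x | `|x| <= 1].

(* supremum (and not sup, which requires K = R) also covers the partial order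
   of R[i]: a least upper bound in R[i] of a set of nonnegative reals is its
   real supremum. *)
Definition op_norm (X Y : normedModType K) (T : X -> Y) : K :=
  supremum 0 [set `|T x| | x in @closed_unit_ball X].

(* L(X, Y) is the set of continuous maps in {linear X -> Y}; for linear maps,
   continuity is boundedness (linear_bounded_continuous). *)
Definition bounded_op (X Y : normedModType K) : set {linear X -> Y} :=
  [set T | continuous T].

Definition QNA (X Y : normedModType K) : set {linear X -> Y} :=
  [set T | bounded_op T /\
    exists2 u, closure (T @` @closed_unit_ball X) u & `|u| = op_norm T].

Definition dense_in_bounded_op (X Y : normedModType K)
    (D : set {linear X -> Y}) : Prop :=
  forall (T : {linear X -> Y}) (eps : K), bounded_op T -> 0 < eps ->
    exists2 S, D S & op_norm (S \- T) < eps.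

Definition closed_convex_hull (X : normedModType K) (A : set X) : set X :=
  closure (smallest (@convex_set K X) A : set X).

Definition dentable (X : normedModType K) (A : set X) : Prop :=
  forall delta : K, 0 < delta ->
    exists2 a, A a & ~ closed_convex_hull (A `\` [set b | `|b - a| < delta]) a.

Definition RNP (X : normedModType K) : Prop :=
  forall A : set X, A !=set0 -> bounded_set A -> dentable A.

End Defs.

Arguments QNA {K} X Y.
Arguments RNP {K} X.

(* Main.v *)
Require Import Defs.
From HB Require Import structures.
From mathcomp Require Import all_boot all_order all_algebra.
From mathcomp Require Import all_classical all_reals all_analysis.
From mathcomp Require Import complex ring lra.

(* If [Z] has the RNP, [D] is a nonempty closed bounded subset of [Z] and [f] is
   Lipschitz on [Z], then arbitrarily small real functionals [l] make [f + l]
   attain its maximum on [D] (Stegall's variational principle).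
   Factor [T] as [Q P] through [Z], where [Z] is [X] or [Y], let [D] be the
   closure of the image under [P] of the unit ball and [f z = |Q z|]. If [f + l]
   is maximal at [b], [L] is the scalar functional with real part [l], and [w] is
   a unit vector in the direction of [Q b], then [S x = T x + L (P x) w] is close
   to [T]. As [D] is stable under multiplication by unit scalars, one may take
   [L b >= 0], and [|S x| <= |Q b| + |L b|] on the unit ball, where the bound is
   approached as [P x -> b].

   Stegall's principle follows from the existence of small slices. Replace [f] by
   a concave Lipschitz envelope; the Bronsted-Rockafellar argument provides, near
   every near maximizer, an exact maximizer of a slightly tilted function. The set
   of these exact maximizers is bounded, hence dentable, and tilting along one of
   its slices confines the near maximizers to a small ball. Iterating, the tilted
   functionals converge while the sets of near maximizers shrink to a point. *)

Set Implicit Arguments.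
Unset Strict Implicit.
Unset Printing Implicit Defensive.

Import Order.TTheory GRing.Theory Num.Theory.
Import numFieldNormedType.Exports.

Local Open Scope classical_set_scope.
Local Open Scope ring_scope.

Lemma scalar_funP (R : pzRingType) (V : lmodType R) (l : V -> R) :
  scalar l <-> (forall x y, l (x + y) = l x + l y) /\
               (forall a x, l (a *: x) = a * l x).
Proof.
split=> [ll|[lD lZ] a x y]; last by rewrite lD lZ.
have lD x y : l (x + y) = l x + l y by have := ll 1 x y; rewrite scale1r mul1r.
split=> // a x; have l0 : l 0 = 0.
  by have /eqP := lD 0 0; rewrite addr0 -subr_eq0 opprD addNKr oppr_eq0 => /eqP.
by have := ll a x 0; rewrite addr0 l0 addr0.
Qed.

(** * The Hahn-Banach and sandwich theorems *)

Section HahnBanach.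
Context {R : realType} {V : lmodType R}.
Implicit Types (p q g l : V -> R) (C : set V) (t : R).

Definition convex C := forall x y t, 0 <= t <= 1 ->
  C x -> C y -> C (t *: x + (1 - t) *: y).

Definition concave_on C g := forall x y t, 0 <= t <= 1 ->
  C x -> C y -> t * g x + (1 - t) * g y <= g (t *: x + (1 - t) *: y).

Definition sublinear p :=
  (forall x y, p (x + y) <= p x + p y) /\
  (forall t x, 0 < t -> p (t *: x) = t * p x).

Lemma sublinear0 p : sublinear p -> p 0 = 0.
Proof. by case=> _ /(_ 2 0 ltac:(by [])); rewrite scaler0; lra. Qed.

Lemma sublinearN p x : sublinear p -> - p (- x) <= p x.
Proof.
move=> sp; have := sp.1 x (- x).
by rewrite subrr sublinear0//; lra.
Qed.

Lemma sublinear_le p : (forall x y, p (x + y) <= p x + p y) ->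
  (forall t x, 0 < t -> p (t *: x) <= t * p x) -> sublinear p.
Proof.
move=> pD pZ; split=> // t x t0; apply/eqP; rewrite eq_le pZ//=.
have ti : 0 < t^-1 by rewrite invr_gt0.
have := pZ t^-1 (t *: x) ti.
by rewrite scalerA mulVf ?gt_eqF// scale1r ler_pdivlMl.
Qed.

(** The pointwise infimum works: at [x] no member drops below [- p0 (- x)], and subadditivity holds
    because the smaller of two members serves both arguments. *)
Lemma sublinear_chain (F : set (V -> R)) : F !=set0 -> F `<=` sublinear ->
  total_on F (fun p q => forall x, q x <= p x) ->
  exists2 q, sublinear q & forall p, F p -> forall x, q x <= p x.
Proof.
move=> [p0 Fp0] Fs Ft.
have lb x : has_lbound [set p x | p in F].
  exists (- p0 (- x)) => _ [p Fp <-].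
  have [h|h] := Ft _ _ Fp0 Fp.
    by rewrite (le_trans _ (sublinearN x (Fs _ Fp)))// lerN2.
  exact: le_trans (sublinearN x (Fs _ Fp0)) (h x).
have ne x : [set p x | p in F] !=set0 by exists (p0 x), p0.
pose q x := inf [set p x | p in F].
have qF p : F p -> forall x, q x <= p x by move=> Fp x; apply: ge_inf => //; exists p.
exists q => //; apply: sublinear_le => [x y|t x t0].
- rewrite -lerBlDr; apply: lb_le_inf => // _ [p Fp <-].
  rewrite lerBlDr -lerBlDl; apply: lb_le_inf => // _ [p' Fp' <-].
  rewrite lerBlDl.
  have [h|h] := Ft _ _ Fp Fp'.
    apply: le_trans (qF _ Fp' _) _; apply: le_trans ((Fs _ Fp').1 _ _) _.
    by rewrite lerD2r.
  apply: le_trans (qF _ Fp _) _; apply: le_trans ((Fs _ Fp).1 _ _) _.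
  by rewrite lerD2l.
- rewrite -ler_pdivrMl//; apply: lb_le_inf => // _ [p Fp <-].
  by rewrite ler_pdivrMl// -(Fs _ Fp).2// qF.
Qed.

(* [p] is the infimum over [t >= 0] and [z] in [C] of [q (v + t z) - t (g z)]. *)
Lemma sublinear_push q C g : sublinear q -> C !=set0 -> convex C ->
  concave_on C g -> (forall x, C x -> g x <= q x) ->
  exists p, [/\ sublinear p, forall x, p x <= q x &
    forall x, C x -> p (- x) <= - g x].
Proof.
move=> sq [c0 Cc0] cC cg gq.
pose S v := [set q (v + tz.1 *: tz.2) - tz.1 * g tz.2 |
  tz in [set tz : R * V | 0 <= tz.1 /\ C tz.2]].
have lb v : has_lbound (S v).
  exists (- q (- v)) => _ [[t z]/= [t0 Cz] <-].
  have h1 : q (t *: z) <= q (v + t *: z) + q (- v).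
    by rewrite (le_trans _ (sq.1 _ _))// addrAC subrr add0r.
  suff : t * g z <= q (t *: z) by lra.
  have [->|tn0] := eqVneq t 0; first by rewrite scale0r sublinear0// mul0r.
  by rewrite sq.2 ?lt_def ?tn0//= ler_wpM2l// gq.
have ne v : S v !=set0 by exists (q (v + 0 *: c0) - 0 * g c0), (0, c0).
pose p v := inf (S v).
have pS v t z : 0 <= t -> C z -> p v <= q (v + t *: z) - t * g z.
  by move=> t0 Cz; apply: ge_inf => //; exists (t, z).
exists p; split.
- apply: sublinear_le => [v w|s v s0].
    rewrite -lerBlDr; apply: lb_le_inf => // _ [[t z]/= [t0 Cz] <-].
    rewrite lerBlDr -lerBlDl; apply: lb_le_inf => // _ [[s y]/= [s0 Cy] <-].
    rewrite lerBlDl.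
    have h : q (v + t *: z + (w + s *: y)) <= q (v + t *: z) + q (w + s *: y).
      exact: sq.1.
    have [ts|ts] := eqVneq (t + s) 0.
      have t00 : t = 0 by lra.
      have s00 : s = 0 by lra.
      have := pS (v + w) 0 z (lexx _) Cz.
      move: h; rewrite t00 s00 !scale0r !addr0; lra.
    have ts0 : 0 < t + s by rewrite lt_def ts addr_ge0.
    (* [t *: z + s *: y] is [t + s] times a convex combination of [z] and [y], where concavity of
       [g] applies. *)
    pose a := t / (t + s).
    have ta : (t + s) * a = t by rewrite /a; field.
    have sa : (t + s) * (1 - a) = s by rewrite /a; field.
    have a01 : 0 <= a <= 1.
      by rewrite divr_ge0 ?(ltW ts0)//= ler_pdivrMr// mul1r lerDl.
    have := pS (v + w) (t + s) _ (ltW ts0) (cC _ _ _ a01 Cz Cy).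
    rewrite scalerDr !scalerA ta sa addrACA.
    have h2 := cg _ _ _ a01 Cz Cy; have {h2} : t * g z + s * g y <=
        (t + s) * g (a *: z + (1 - a) *: y).
      rewrite -(ler_pM2l ts0) in h2; apply: le_trans h2.
      by rewrite mulrDr (mulrA _ a) (mulrA _ (1 - a)) ta sa.
    lra.
  rewrite -ler_pdivrMl//; apply: lb_le_inf => // _ [[t z]/= [t0 Cz] <-].
  rewrite ler_pdivrMl// mulrBr -sq.2// scalerDr scalerA mulrA.
  by apply: pS => //; rewrite mulr_ge0// ltW.
- by move=> v; have := pS v 0 c0 (lexx _) Cc0; rewrite scale0r addr0 mul0r subr0.
- move=> z Cz; have := pS (- z) 1 z ler01 Cz.
  by rewrite scale1r addNr sublinear0// mul1r add0r.
Qed.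

(* A minimal sublinear functional is linear: by minimality, pushing it at a point
   [x] does not change it. *)
Lemma hahn_banach q : sublinear q ->
  exists2 l, scalar l & forall x, l x <= q x.
Proof.
move=> sq; pose T := {p : V -> R | sublinear p /\ forall x, p x <= q x}.
pose le (p p' : T) := `[< forall x, sval p' x <= sval p x >].
have q_in : sublinear q /\ forall x, q x <= q x by [].
(* [le] reverses the pointwise order, so Zorn's lemma yields a minimal sublinear functional. *)
have [||F Ft|[l [sl lq]] lmin] := @ZL_preorder T (exist _ q q_in) le.
- by move=> p; apply/asboolP.
- by move=> p1 p2 p3 /asboolP h1 /asboolP h2; apply/asboolP => x; apply: le_trans (h1 x).
- have [F0|/set0P F0] := eqVneq F set0.
    by exists (exist _ q q_in) => s; rewrite F0.
  have [|_ [p _ <-]|_ _ [p Fp <-] [p' Fp' <-]|p sp pF] :=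
    @sublinear_chain [set sval p | p in F].
  + by case: F0 => p Fp; exists (sval p), p.
  + exact: (svalP p).1.
  + by case: (Ft _ _ Fp Fp') => /asboolP; [left|right].
  have pq x : p x <= q x.
    case: F0 => p' Fp'; apply: le_trans (pF (sval p') _ x) ((svalP p').2 x).
    by exists p'.
  exists (exist _ p (conj sp pq)) => s Fs; apply/asboolP => x.
  by apply: pF; exists s.
have lN x : l (- x) = - l x.
  have [|y z t _ ->->|y z t _ _ _|_ ->|p [sp pl px]] :=
      @sublinear_push l [set x] (fun=> l x) sl.
  + by exists x.
  + by rewrite /= -scalerDl addrC subrK scale1r.
  + by lra.
  + by [].
  have pq y : p y <= q y by apply: le_trans (pl y) (lq y).
  have /asboolP/= lp : le (exist _ p (conj sp pq)) (exist _ l (conj sl lq)).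
    by apply: lmin; apply/asboolP.
  apply/eqP; rewrite eq_le (le_trans (lp _) (px x erefl))/=.
  by have := sublinearN x sl; lra.
exists l => //; apply/scalar_funP; split=> [x y|a x].
  apply/eqP; rewrite eq_le sl.1/=.
  by have := sl.1 (- x) (- y); rewrite -opprD !lN; lra.
have [a0|a0|<-] := ltrgtP 0 a; [exact: sl.2| |].
  by rewrite -{1}[a]opprK scaleNr lN sl.2 ?oppr_gt0// mulNr opprK.
by rewrite scale0r mul0r sublinear0.
Qed.

(** A linear [l] below the pushed functional satisfies [l (- x) <= - g x] on [C], which is the lower
    bound sought. *)
Lemma sandwich q C g : sublinear q -> convex C ->
  concave_on C g -> (forall x, C x -> g x <= q x) ->
  exists l, [/\ scalar l, forall x, l x <= q x & forall x, C x -> g x <= l x].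
Proof.
move=> sq cC cg gq; have [C0|/set0P C0] := eqVneq C set0.
  by have [l sl lq] := hahn_banach sq; exists l; split=> // x; rewrite C0.
have [p [sp pq pg]] := sublinear_push sq C0 cC cg gq.
have [l sl lp] := hahn_banach sp; exists l; split=> // [x|x Cx].
  exact: le_trans (pq x).
have lN : l (- x) = - l x by rewrite -scaleN1r ((scalar_funP _).1 sl).2 mulN1r.
by have := le_trans (lp (- x)) (pg x Cx); rewrite lN lerN2.
Qed.

End HahnBanach.

(** * Ekeland's principle and the Bronsted-Rockafellar theorem *)

Lemma invS_le (R : realType) (e : R) : 0 < e -> exists n : nat, n.+1%:R^-1 <= e.
Proof.
move=> e0; exists (Num.truncn e^-1).
rewrite -[leRHS]invrK lef_pV2 ?posrE ?invr_gt0// ltW//.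
exact: truncnS_gt.
Qed.

Section Seminorm.
Context {R : realType} {V : lmodType R}.
Implicit Types (N H l : V -> R) (e r a C M lam : R).

(** Working with a real seminorm on a bare real vector space lets one argument serve normed spaces
    over both fields. *)
Definition seminorm N :=
  (forall x y, N (x + y) <= N x + N y) /\ (forall a x, N (a *: x) = `|a| * N x).

Definition seminorm_complete N := forall u : nat -> V,
  (forall e : R, 0 < e -> exists n0, forall m n, (n0 <= m)%N -> (n0 <= n)%N ->
     N (u m - u n) <= e) ->
  exists b : V, forall e : R, 0 < e -> exists n0, forall n, (n0 <= n)%N ->
     N (u n - b) <= e.

Definition dual_ball N r : set (V -> R) :=
  [set l | scalar l /\ forall x, l x <= r * N x].

Definition lip N C H := 0 <= C /\ forall x y, H x <= H y + C * N (x - y).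

Definition concave H := concave_on setT H.

Context {N : V -> R} (sN : seminorm N).

Lemma seminorm0 : N 0 = 0.
Proof. by rewrite -(scale0r 0) sN.2 normr0 mul0r. Qed.

Lemma seminormN x : N (- x) = N x.
Proof. by rewrite -scaleN1r sN.2 normrN normr1 mul1r. Qed.

Lemma seminormB x y : N (x - y) = N (y - x).
Proof. by rewrite -seminormN opprB. Qed.

Lemma seminorm_ge0 x : 0 <= N x.
Proof. by have := sN.1 x (- x); rewrite subrr seminorm0 seminormN; lra. Qed.

Lemma seminorm_trans y x z : N (x - z) <= N (x - y) + N (y - z).
Proof. by rewrite (le_trans _ (sN.1 _ _))// addrA subrK. Qed.

Lemma seminorm_sublinear r : 0 <= r -> sublinear (fun x => r * N x).
Proof.
move=> r0; split=> [x y|t x t0]; first by rewrite -mulrDr ler_wpM2l// sN.1.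
by rewrite sN.2 gtr0_norm// mulrCA.
Qed.

Lemma dual_ballN r l x : dual_ball N r l -> - l x <= r * N x.
Proof.
move=> [/scalar_funP[_ lZ] lr]; rewrite -seminormN (le_trans _ (lr _))//.
by rewrite -scaleN1r lZ mulN1r.
Qed.

Lemma dual_ballW r (s : R) l : r <= s -> dual_ball N r l -> dual_ball N s l.
Proof.
move=> rs [sl lr]; split=> // x; apply: le_trans (lr x) _.
by rewrite ler_wpM2r// seminorm_ge0.
Qed.

Lemma dual_ball_lin r (s : R) a l l' : 0 <= a -> dual_ball N r l -> dual_ball N s l' ->
  dual_ball N (r + a * s) (fun x => l x + a * l' x).
Proof.
move=> a0 [/scalar_funP[lD lZ] lr] [/scalar_funP[lD' lZ'] lr']; split=> [|x].
  by apply/scalar_funP; split=> [x y|b x]; rewrite ?lD ?lD' ?lZ ?lZ'; ring.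
by rewrite mulrDl lerD// -mulrA ler_wpM2l.
Qed.

Lemma dual_ball_add r (s : R) l l' : dual_ball N r l -> dual_ball N s l' ->
  dual_ball N (r + s) (fun x => l x + l' x).
Proof.
move=> /(dual_ball_lin ler01)/[apply]; rewrite mul1r.
by under eq_fun do rewrite mul1r.
Qed.

Lemma dual_ball0 : dual_ball N 0 (fun=> 0).
Proof.
by split=> [|x]; [apply/scalar_funP; split=> *; rewrite ?addr0 ?mulr0|rewrite mul0r].
Qed.

Lemma norming (a : V) : exists2 l, dual_ball N 1 l & N a <= l a.
Proof.
have [||||l [sl lN la]] :=
  @sandwich _ _ (fun x => 1 * N x) [set a] (fun=> N a).
- exact: seminorm_sublinear.
- by move=> y z t _ ->->; rewrite /= -scalerDl addrC subrK scale1r.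
- by move=> y z t _ _ _; lra.
- by move=> _ ->; rewrite mul1r.
- by exists l => //; apply: la.
Qed.

Hypothesis cN : seminorm_complete N.

(** Any choice of points [u n] in [D n] is Cauchy. As the sets need not be closed, its limit is only
    adherent to each of them. *)
Lemma cantor_intersection (D : nat -> set V) :
  (forall n, D n !=set0) ->
  (forall n, D n.+1 `<=` D n) ->
  (forall e : R, 0 < e -> exists n c, forall x, D n x -> N (x - c) <= e) ->
  exists b, forall n (e : R), 0 < e -> exists2 x, D n x & N (x - b) <= e.
Proof.
move=> D0 DS Dsmall; have [u uD] := choice D0.
have Dm m n : (m <= n)%N -> D n `<=` D m.
  move=> /subnK <-; elim: (n - m)%N => // k IH; rewrite addSn.
  exact: subset_trans (DS _) IH.
have [|b ub] := @cN u; last first.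
  exists b => n e /ub[n0 un0]; exists (u (maxn n n0)).
    by apply: Dm (uD _); rewrite leq_maxl.
  by apply: un0; rewrite leq_maxr.
move=> e e0; have [|n [c nc]] := Dsmall (e / 2); first by rewrite divr_gt0.
exists n => i j ni nj; apply: le_trans (seminorm_trans c _ _) _.
rewrite [e]splitr lerD//; first exact/nc/(Dm _ _ ni).
by rewrite seminormB; exact/nc/(Dm _ _ nj).
Qed.

Lemma ekeland H C M lam (a : V) : lip N C H -> (forall x, H x <= M) -> 0 < lam ->
  exists b, H a + lam * N (b - a) <= H b /\
    forall z, H z <= H b + lam * N (z - b).
Proof.
move=> [C0 HC] HM lam0.
(* [S x y] says that the gain in [H] pays for the move from [x] to [y] at price [lam]. This is a
   preorder, and the sequence below climbs along it, each time to a point nearly maximizing [H]. *)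
pose S x := [set y | H x + lam * N (y - x) <= H y].
have Sxx x : S x x by rewrite /S/= subrr seminorm0 mulr0 addr0.
have Strans x y z : S x y -> S y z -> S x z.
  rewrite /S/= => xy yz; have := seminorm_trans y z x.
  rewrite -(ler_pM2l lam0) mulrDr; lra.
have SH x y : S x y -> H x <= H y.
  apply: le_trans; rewrite lerDl mulr_ge0// ?seminorm_ge0//; exact: ltW.
pose step (s t : nat * V) := t.1 = s.1.+1 /\ S s.2 t.2 /\
  forall z, S s.2 z -> H z <= H t.2 + s.1.+1%:R^-1.
have stepP s : {t | step s t}.
  apply: cid; case: s => n x.
  have hs : has_sup [set H y | y in S x].
    by split; [exists (H x), x|exists M => _ [y _ <-]].
  have n0 : 0 < n.+1%:R^-1 :> R by rewrite invr_gt0.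
  have [_ [y Sy <-] hy] := sup_adherent n0 hs.
  exists (n.+1, y); do 2 split => //=; move=> z Sz.
  rewrite -lerBlDr ltW// (le_lt_trans _ hy)// lerD2r.
  by apply: sup_upper_bound => //; exists z.
have [u [u0 uS]] := dependent_choice stepP (0%N, a).
have u1 n : (u n).1 = n by elim: n => [|n IH]; rewrite ?u0// (uS n).1 IH.
pose v n := (u n).2.
have vS n : S (v n) (v n.+1) by exact: (uS n).2.1.
have vH n z : S (v n) z -> H z <= H (v n.+1) + n.+1%:R^-1.
  by move=> /((uS n).2.2 z); rewrite u1.
have [|||b hb] := cantor_intersection (D := S \o v).
- by move=> n; exists (v n); exact: Sxx.
- by move=> n z; exact: Strans.
(* From [v n.+1] a gain of at most [n.+1%:R^-1] is left, which bounds [lam] times the distance to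
   any point of [S (v n.+1)]. *)
- move=> e e0; have [n ne] := invS_le (mulr_gt0 lam0 e0).
  exists n.+1, (v n.+1) => z /= Sz.
  rewrite -(ler_pM2l lam0); apply: le_trans ne.
  have := vH n z (Strans _ _ _ (vS n) Sz); have : H (v n.+1) + _ <= H z := Sz.
  by set k := n.+1%:R^-1; lra.
(* [S (v n)] is closed because [H] is Lipschitz. *)
have Sb n : S (v n) b.
  rewrite /S/=; apply/ler_addgt0Pr => e e0.
  have CL : 0 < C + lam by lra.
  have [x Sx xb] := hb n (e / (C + lam)) (divr_gt0 e0 CL).
  move: Sx; rewrite /S/= => Sx.
  have h1 := HC x b; have := seminorm_trans x b (v n); rewrite [N (b - x)]seminormB.
  rewrite -(ler_pM2l lam0) mulrDr => h2.
  move: xb; rewrite ler_pdivlMr// mulrDr; lra.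
exists b; split; first by have := Sb 0%N; rewrite /v u0.
(* A [z] violating the bound would lie in every [S (v n)], where [H] exceeds [H b] by at most
   [n.+1%:R^-1]. *)
move=> z; rewrite leNgt; apply/negP => zb.
have Sbz : S b z by exact: ltW.
suff : H z <= H b.
  by have := mulr_ge0 (ltW lam0) (seminorm_ge0 (z - b)); lra.
apply/ler_addgt0Pr => e e0; have [n ne] := invS_le e0.
apply: le_trans (vH n z (Strans _ _ _ (Sb n) Sbz)) _.
by rewrite lerD// SH.
Qed.

(** At Ekeland's point [b], the concave increment [H (b + z) - H b] lies below [lam * N z]. A linear
    functional in between, with its sign changed, is the tilt. *)
Lemma bronsted_rockafellar H C M lam (a : V) : concave H -> lip N C H ->
  (forall x, H x <= M) -> 0 < lam ->
  exists b l, [/\ H a + lam * N (b - a) <= H b, dual_ball N lam l &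
    forall z, H z + l z <= H b + l b].
Proof.
move=> cH HC HM lam0; have [b [hab hb]] := ekeland a HC HM lam0.
have [||||l [/scalar_funP[lD lZ] lN hl]] :=
  @sandwich _ _ (fun x => lam * N x) setT (fun z => H (b + z) - H b).
- exact/seminorm_sublinear/ltW.
- by [].
- move=> x y t t01 _ _; have := cH (b + x) (b + y) t t01 I I.
  rewrite [X in _ <= H X](_ : _ = b + (t *: x + (1 - t) *: y)); first by lra.
  by rewrite !scalerDr addrACA -scalerDl [t + _]addrC subrK scale1r.
- by move=> x _; have := hb (b + x); rewrite addrAC subrr add0r; lra.
exists b, (fun x => l (- x)); split=> //.
  split=> [|x]; last by rewrite -seminormN.
  by apply/scalar_funP; split=> [x y|t x]; rewrite ?opprD ?lD// -scalerN lZ.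
move=> z; have := hl (z - b) I; rewrite [b + _]addrC subrK lD.
have lN' x : l (- x) = - l x by rewrite -scaleN1r lZ mulN1r.
by rewrite !lN'; lra.
Qed.

End Seminorm.

(** * Stegall's variational principle *)

Section Slices.
Context {R : realType} {V : lmodType R}.
Implicit Types (N H l f : V -> R) (C M r rho delta gamma eta : R).

(** [S] plays the convex hull of the points of [A] far from [a]; the gap [gamma] expresses that [a]
    is outside its closure. *)
Definition dentable_sets N := forall (A : set V) M delta, A !=set0 ->
  (forall a, A a -> N a <= M) -> 0 < delta ->
  exists a (S : set V) gamma, [/\ A a, 0 < gamma, convex S,
    forall b, A b -> delta <= N (b - a) -> S b &
    forall c, S c -> gamma <= N (a - c)].

Context {N : V -> R} (sN : seminorm N).

Lemma separation (S : set V) (a : V) (gamma : R) : convex S ->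
  (forall c, S c -> gamma <= N (a - c)) ->
  exists2 l, dual_ball N 1 l & forall c, S c -> gamma <= l a - l c.
Proof.
move=> cS Sg; have [||||l [sl lN hl]] :=
  @sandwich _ _ (fun x => 1 * N x) [set z | S (a - z)] (fun=> gamma).
- exact: (seminorm_sublinear sN).
- move=> x y t t01 /= Sx Sy.
  suff -> : a - (t *: x + (1 - t) *: y) = t *: (a - x) + (1 - t) *: (a - y).
    exact: cS.
  by rewrite !scalerBr addrACA -scalerDl [t + _]addrC subrK scale1r opprD.
- by move=> y z t _ _ _; lra.
- by move=> x /Sg; rewrite opprB addrC subrK mul1r.
- exists l => // c Cc; have /scalar_funP[lD lZ] := sl.
  have lB : l (a - c) = l a - l c by rewrite lD -scaleN1r lZ mulN1r.
  by rewrite -lB; apply: hl; rewrite /= opprB addrC subrK.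
Qed.

Lemma lip_add C r H l : lip N C H -> 0 <= r -> dual_ball N r l ->
  lip N (C + r) (fun x => H x + l x).
Proof.
move=> [C0 HC] r0 [/scalar_funP[lD lZ] lr]; split=> [|x y]; first by lra.
have := HC x y; have := lr (x - y).
by rewrite lD -[- y]scaleN1r lZ scaleN1r; lra.
Qed.

Lemma concave_add H l : concave H -> scalar l -> concave (fun x => H x + l x).
Proof.
move=> cH /scalar_funP[lD lZ] x y t t01 _ _.
by have := cH x y t t01 I I; rewrite lD !lZ; lra.
Qed.

Hypothesis cN : seminorm_complete N.
Hypothesis dN : dentable_sets N.

(* A slice, in a direction [y], of the set of exact maximizers of the
   perturbations [H + l] with [l] small; tilting [H + l] by [t y] pushes its
   near maximizers into that slice. *)
Lemma small_slice H C rho M delta : concave H -> lip N C H -> 0 < rho ->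
  (forall l, dual_ball N rho l -> exists K, forall x, H x + l x <= K) ->
  (forall r l a, r < rho -> dual_ball N r l ->
     (forall z, H z + l z <= H a + l a) -> N a <= M) ->
  0 < delta ->
  exists r l eta c, [/\ 0 <= r < rho, dual_ball N r l, 0 < eta &
    forall z, (forall y, H y + l y <= H z + l z + eta) -> N (z - c) <= delta].
Proof.
move=> cH HC rho0 Hbd HM delta0.
pose A := [set a | exists r l, [/\ r < rho, dual_ball N r l &
  forall z, H z + l z <= H a + l a]].
have A0 : A !=set0.
  have [|K HK] := Hbd (fun=> 0); first exact: (dual_ballW sN (ltW rho0) dual_ball0).
  have rho2 : 0 < rho / 2 by rewrite divr_gt0.
  have [|b [l [_ lr hb]]] := bronsted_rockafellar sN cN 0 (M := K) cH HC _ rho2.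
    by move=> x; have := HK x; rewrite addr0.
  by exists b, (rho / 2), l; split=> //; lra.
have AM a : A a -> N a <= M by move=> [r [l [rr lr la]]]; exact: HM lr la.
have delta2 : 0 < delta / 2 by rewrite divr_gt0.
have [a [S [gamma [[r0 [l0 [r0r l0r la]]] gamma0 cS AS Sg]]]] := dN A0 AM delta2.
have [y y1 yS] := separation cS Sg.
pose r := Num.max r0 0.
have rr : r < rho by rewrite gt_max r0r rho0.
have r00 : 0 <= r by rewrite le_max lexx orbT.
have {}l0r : dual_ball N r l0 by apply: (dual_ballW sN _ l0r); rewrite le_max lexx.
(* [r + t + lam] stays below [rho], so an exact maximizer obtained after tilts of sizes [t] and
   [lam] is still in [A]. *)
pose t := (rho - r) / 2; have t0 : 0 < t by rewrite divr_gt0// subr_gt0.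
have lt : dual_ball N (r + t) (fun x => l0 x + t * y x).
  by rewrite -[X in r + X]mulr1; apply: dual_ball_lin => //; exact: ltW.
set l := fun x => _ in lt.
pose lam := (rho - r) / 4; have lam0 : 0 < lam by rewrite divr_gt0// subr_gt0.
(* The first term will keep the exact maximizer [b] out of [S], the second will keep [z] within
   [delta / 2] of [b]. *)
pose eta := Num.min (t * gamma / 2) (lam * (delta / 2)).
have eta0 : 0 < eta.
  by rewrite lt_min (mulr_gt0 lam0 delta2) andbT divr_gt0// mulr_gt0.
have eta1 : eta <= t * gamma / 2 by rewrite ge_min lexx.
have eta2 : eta <= lam * (delta / 2) by rewrite ge_min lexx orbT.
have rt0 : 0 <= r + t by rewrite addr_ge0// ltW.
exists (r + t), l, eta, a; split=> //; first by rewrite rt0/= /t; lra.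
move=> z hz; have [|K HK] := Hbd l.
  by apply: (dual_ballW sN _ lt); rewrite /t; lra.
have [b [w [hzb wl hb]]] := bronsted_rockafellar sN cN z (concave_add cH lt.1)
  (lip_add HC rt0 lt) HK lam0.
have zb : N (b - z) <= delta / 2.
  by rewrite -(ler_pM2l lam0); have := hz b; lra.
have Ab : A b.
  exists (r + t + lam), (fun x => l x + w x); split.
  - by rewrite /t /lam; lra.
  - exact: dual_ball_add.
  - by move=> x; have := hb x; rewrite -!addrA.
(* Since [a] maximizes [H + l0], if [b] were in [S] then [a] would beat [b] by [t * gamma] for
   [H + l], whereas near maximality of [z] allows only [eta]. *)
have ba : N (b - a) < delta / 2.
  rewrite ltNge; apply/negP => /(AS _ Ab)/yS.
  rewrite -(ler_pM2l t0) => h1.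
  have h2 := la b; have h3 := hz a.
  have h4 := mulr_ge0 (ltW lam0) (seminorm_ge0 sN (b - z)).
  have h5 : 0 < t * gamma by rewrite mulr_gt0.
  by move: hzb h3 h1; rewrite /l; lra.
apply: le_trans (seminorm_trans sN b _ _) _.
by rewrite [N (z - b)]seminormB// [delta]splitr lerD// ltW.
Qed.
End Slices.

Section Stegall.
Context {R : realType} {V : lmodType R}.
Implicit Types (N G l x f : V -> R) (D : set V) (c k C M rho delta eps : R).

Context {N : V -> R} (sN : seminorm N).

(* [G] is the concave envelope of [f] on [D], computed with affine majorants of
   slope at most [eps] only: this keeps it finite and Lipschitz on all of [V]. *)
Lemma concave_envelope D f c eps : D !=set0 -> (forall d, D d -> f d <= c) ->
  0 <= eps -> exists G, [/\ concave G, lip N eps G, forall d, D d -> f d <= G d &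
    forall l k, dual_ball N eps l -> (forall d, D d -> f d + l d <= k) ->
      forall z, G z + l z <= k].
Proof.
move=> [d0 Dd0] fc eps0.
pose P := [set lk : (V -> R) * R | dual_ball N eps lk.1 /\
  forall d, D d -> f d + lk.1 d <= lk.2].
pose S z := [set lk.2 - lk.1 z | lk in P].
have S0 z : S z !=set0.
  exists (c - 0), (fun=> 0, c) => //=; split=> [|d Dd] /=; last by rewrite addr0 fc.
  exact: (dual_ballW sN _ dual_ball0).
have Slb z : has_lbound (S z).
  exists (f d0 - eps * N d0 - eps * N z) => _ [[l k]/= [/= leps lk] <-].
  by have := dual_ballN sN d0 leps; have := leps.2 z; have := lk _ Dd0; lra.
pose G z := inf (S z).
have GS z l k : dual_ball N eps l -> (forall d, D d -> f d + l d <= k) ->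
  G z <= k - l z by move=> leps lk; apply: ge_inf => //; exists (l, k).
exists G; split.
- move=> y z t /andP[t0 t1] _ _; apply: lb_le_inf => // _ [[l k]/= [/= leps lk] <-].
  have /scalar_funP[-> lZ] := leps.1; rewrite !lZ.
  have t1' : 0 <= 1 - t by rewrite subr_ge0.
  have := ler_wpM2l t0 (GS y l k leps lk); have := ler_wpM2l t1' (GS z l k leps lk).
  by lra.
- split=> // y z; rewrite -lerBlDr; apply: lb_le_inf => // _ [[l k]/= [/= leps lk] <-].
  have /scalar_funP[lD lZ] := leps.1.
  have := GS y l k leps lk; have := dual_ballN sN (y - z) leps.
  by rewrite lD -[- z]scaleN1r lZ scaleN1r; lra.
- move=> d Dd; apply: lb_le_inf => // _ [[l k]/= [/= leps lk] <-].
  by have := lk _ Dd; lra.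
- by move=> l k leps lk z; have := GS z l k leps lk; lra.
Qed.

Hypothesis cN : seminorm_complete N.
Hypothesis dN : dentable_sets N.

Context {D : set V} {f : V -> R} {c M eps : R}.
Hypotheses (D0 : D !=set0) (fc : forall d, D d -> f d <= c).
Hypotheses (DM : forall d, D d -> N d <= M) (eps0 : 0 < eps).

(* A state of the iteration: later functionals stay within [rho] of [x]. *)
Let admissible x rho := 0 < rho <= eps /\ dual_ball N (eps - rho) x.

(** The control is uniform over a ball around [x], so that the limit functional of the iteration
    inherits it. *)
Let slice_control x rho delta := exists z kap, 0 < kap /\
  forall l, dual_ball N rho (fun v => l v - x v) ->
    forall d, D d -> (forall d', D d' -> f d' + l d' <= f d + l d + kap) ->
      N (d - z) <= delta.

Let stegall_step x rho delta : admissible x rho -> 0 < delta ->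
  exists x' rho', [/\ admissible x' rho',
    dual_ball N (rho - rho') (fun v => x' v - x v) & slice_control x' rho' delta].
Proof.
move=> [/andP[rho0 rhoeps] xr] delta0.
have [G [cG lG fG Gk]] := concave_envelope D0 fc (ltW eps0).
have M0 : 0 <= M by have [d /DM] := D0; apply: le_trans (seminorm_ge0 sN d).
have lH := lip_add lG (ltac:(rewrite subr_ge0//) : 0 <= eps - rho) xr.
have [||r [l [eta [z [/andP[r0 rrho] lr eta0 hz]]]]] :=
  small_slice sN cN dN (M := M) (concave_add cG xr.1) lH rho0 _ _ delta0.
- move=> l lrho; exists (c + eps * M) => y.
  have xl : dual_ball N eps (fun v => x v + l v).
    by rewrite -[eps](subrK rho); exact: dual_ball_add.
  rewrite -addrA; apply: (Gk _ _ xl) => d Dd; apply: lerD; first exact: fc.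
  by apply: le_trans (xl.2 d) _; rewrite ler_wpM2l ?DM// ltW.
(* The remaining slope [rho - r] is spent on a functional norming [a]. The total slope is then
   [eps], so an upper bound valid on [D] carries over to the envelope at [a] and gives
   [N a <= M]. *)
- move=> r l a rrho lr la.
  have [v v1 va] := norming sN a.
  have rr0 : 0 < rho - r by rewrite subr_gt0.
  have h := dual_ball_lin (ltW rr0) (dual_ball_add xr lr) v1.
  rewrite mulr1 [_ + (rho - r)](_ : _ = eps) in h; last by ring.
  rewrite -(ler_pM2l rr0).
  have := Gk _ (G a + x a + l a + (rho - r) * M) h. move=> /(_ _ a).
  have := ler_wpM2l (ltW rr0) va => h1 h2.
  suff : G a + (x a + l a + (rho - r) * v a) <= G a + x a + l a + (rho - r) * M.
    by lra.
  apply: h2 => d Dd.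
  have := la d; have := fG _ Dd; have := ler_wpM2l (ltW rr0) (DM Dd).
  by have := ler_wpM2l (ltW rr0) (v1.2 d); rewrite mul1r; lra.
(* A perturbation of size [rho'] changes differences of values on [D] by at most
   [2 * rho' * M <= eta / 2]; the other half of [eta] is the tolerance. *)
pose rho' := Num.min (rho - r) (eta / (4 * (M + 1))).
have M1 : 0 < 4 * (M + 1) by lra.
have rho'0 : 0 < rho' by rewrite lt_min subr_gt0 rrho divr_gt0.
have rho'1 : rho' <= rho - r by rewrite ge_min lexx.
have rho'2 : rho' * (4 * (M + 1)) <= eta by rewrite -ler_pdivlMr// ge_min lexx orbT.
have xl : dual_ball N (eps - rho + r) (fun v => x v + l v) by exact: dual_ball_add.
exists (fun v => x v + l v), rho'; split.
- split; first by rewrite rho'0 (le_trans rho'1)//; lra.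
  by apply: (dual_ballW sN _ xl); lra.
- under eq_fun do rewrite addrC addKr.
  by apply: (dual_ballW sN _ lr); lra.
- exists z, (eta / 2); split; first by rewrite divr_gt0.
  move=> l' l'r d Dd hd; apply: hz => y.
  have xle : dual_ball N eps (fun v => x v + l v) by apply: (dual_ballW sN _ xl); lra.
  have : G y + (x y + l y) <= f d + (x d + l d) + eta; last first.
    by have := fG _ Dd; lra.
  apply: (Gk _ _ xle) => d' Dd'.
  have := hd _ Dd'; have := l'r.2 d; have := dual_ballN sN d' l'r.
  have := ler_wpM2l (ltW rho'0) (DM Dd); have := ler_wpM2l (ltW rho'0) (DM Dd').
  lra.
Qed.

Hypothesis D_closed :
  forall b, (forall e : R, 0 < e -> exists2 x, D x & N (x - b) <= e) -> D b.

Theorem stegall C : lip N C f ->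
  exists l b, [/\ dual_ball N eps l, D b & forall d, D d -> f d + l d <= f b + l b].
Proof.
move=> lf; pose T := {s : (V -> R) * R | admissible s.1 s.2}.
pose next (s t : nat * T) := [/\ t.1 = s.1.+1,
  dual_ball N ((sval s.2).2 - (sval t.2).2) (fun v => (sval t.2).1 v - (sval s.2).1 v)
  & slice_control (sval t.2).1 (sval t.2).2 s.1.+1%:R^-1].
have nextP s : {t | next s t}.
  apply: cid; case: s => n [[x rho] /= xr].
  have [|x' [rho' [adm h1 h2]]] := stegall_step (delta := n.+1%:R^-1) xr.
    by rewrite invr_gt0.
  by exists (n.+1, exist _ (x', rho') adm).
have adm0 : admissible (fun=> 0) eps.
  by split; [rewrite eps0 lexx|rewrite subrr; exact: dual_ball0].
have [u [u0 uS]] := dependent_choice nextP (0%N, exist _ (fun=> 0, eps) adm0).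
have u1 n : (u n).1 = n.
  by elim: n => [|n IH]; [rewrite u0|case: (uS n) => ->; rewrite IH].
pose x n := (sval (u n).2).1; pose rho n := (sval (u n).2).2.
have xadm n : admissible (x n) (rho n) by exact: (svalP (u n).2).
pose p n v := x n v + rho n * N v.
have pS n v : p n.+1 v <= p n v.
  by case: (uS n) => _ [_ /(_ v)] + _; rewrite /p /x /rho; lra.
have pn m n v : (m <= n)%N -> p n v <= p m v.
  by move=> /subnK <-; elim: (n - m)%N => // k; exact/le_trans/pS.
(* The [p n] decrease, and any linear [l] below all of them is within [rho n] of
   each [x n]: it serves as the limit of the [x n]. *)
have [|_ [n _ <-]|_ _ [m _ <-] [n _ <-]|q sq qp] := @sublinear_chain R V (range p).
- by exists (p 0%N), 0%N.
- have [/andP[r0 _] [/scalar_funP[xD xZ] _]] := xadm n.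
  have [sD sZ] := seminorm_sublinear sN (ltW r0).
  by split=> [v w|t v t0]; rewrite /p ?xD ?xZ ?sZ//; [have := sD v w|]; lra.
- by have [mn|/ltnW nm] := leqP m n; [left|right] => v; exact: pn.
have [l sl lq] := hahn_banach sq.
have lx n : dual_ball N (rho n) (fun v => l v - x n v).
  have /scalar_funP[lD lZ] := sl; have [_ [/scalar_funP[xD xZ] _]] := xadm n.
  split=> [|v]; first by apply/scalar_funP; split=> *; rewrite ?lD ?xD ?lZ ?xZ; ring.
  by rewrite lerBlDl; apply: le_trans (lq v) _; apply: (qp (p n)); exists n.
have leps : dual_ball N eps l.
  by have := lx 0%N; rewrite /x /rho u0/=; under eq_fun do rewrite subr0.
pose S n := [set d | D d /\ forall d', D d' -> f d' + l d' <= f d + l d + n.+1%:R^-1].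
have [n|n d [Dd hd]|e e0|b hb] := cantor_intersection sN cN (D := S).
- have hs : has_sup [set f d + l d | d in D].
    split; first by have [d Dd] := D0; exists (f d + l d), d.
    exists (c + eps * M) => _ [d Dd <-]; apply: lerD; first exact: fc.
    by apply: le_trans (leps.2 d) _; rewrite ler_wpM2l ?DM// ltW.
  have n0 : 0 < n.+1%:R^-1 :> R by rewrite invr_gt0.
  have [_ [d Dd <-] hd] := sup_adherent n0 hs.
  exists d; split=> // d' Dd'; rewrite -lerBlDr ltW// (le_lt_trans _ hd)// lerD2r.
  by apply: sup_upper_bound => //; exists d'.
- split=> // d' /hd/le_trans; apply; rewrite lerD2l lef_pV2 ?posrE//.
  by rewrite ler_nat.
(* [l] lies in the ball where the control of state [n.+1] holds, so its near maximizers with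
   tolerance [kap] are within [n.+1%:R^-1] of one point. *)
- have [n ne] := invS_le e0.
  case: (uS n) => _ _ [z [kap [kap0 hz]]].
  have [m mk] := invS_le kap0; exists m, z => d [Dd hd].
  apply: le_trans ne; rewrite u1 in hz; apply: (hz l (lx n.+1)) => //.
  by move=> d' /hd/le_trans; apply; rewrite lerD2l.
- exists l, b; split=> //.
    by apply: D_closed => e /(hb 0%N)[d [Dd _] db]; exists d.
  (* [f + l] is Lipschitz with constant [C + eps], so near maximizers close to [b] bound its value
     at [b] from below. *)
  move=> d Dd; apply/ler_addgt0Pr => e e0.
  have [C0 HC] := lip_add lf (ltW eps0) leps.
  have e2 : 0 < e / 2 by rewrite divr_gt0.
  have C1 : 0 < C + eps + 1 by rewrite ltr_wpDl.
  have [n ne] := invS_le e2.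
  have [y [_ hy] yb] := hb n _ (divr_gt0 e2 C1).
  have h1 := hy _ Dd; have h2 := HC y b; have h3 := ler_wpM2l C0 yb.
  have h4 : (C + eps) * (e / 2 / (C + eps + 1)) <= e / 2.
    by rewrite mulrCA ger_pMr// ler_pdivrMr// mul1r; lra.
  move: h1 ne {yb h2 h3 h4} (le_trans h2 (lerD (lexx _) (le_trans h3 h4))).
  by set k := n.+1%:R^-1; lra.
Qed.

End Stegall.

(** * Real and complex scalars *)

(* The embedding and real part that let the cases K = R and K = R[i] be treated
   together; [rf_lift] is the scalar functional with a given real part. *)
Record real_form (R : realType) (K : numFieldType) (iota : {rmorphism R -> K})
    (re : K -> R) : Prop := RealForm {
  rf_le : forall a b, (iota a <= iota b) = (a <= b);
  rf_reZ : forall a k, re (iota a * k) = a * re k;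
  rf_re1 : re 1 = 1;
  rf_ge0 : forall k, 0 <= k -> iota (re k) = k;
  rf_re_norm : forall k, re k <= re `|k|;
  rf_lift : forall (Z : lmodType K) (l : Z -> R),
    (forall x y, l (x + y) = l x + l y) ->
    (forall a x, l (iota a *: x) = a * l x) ->
    exists2 L : Z -> K, scalar L & forall x, re (L x) = l x }.

(** A copy of [Z], so that its real structure does not interfere with the one over [K]; the
    parameter [iota] records which restriction of scalars is meant. *)
Definition realified (R : realType) (K : numFieldType)
  (iota : {rmorphism R -> K}) (Z : lmodType K) : Type := Z.

Section Realified.
Context {R : realType} {K : numFieldType} (iota : {rmorphism R -> K}).
Variable Z : lmodType K.

Let scale (a : R) (x : realified iota Z) : realified iota Z := iota a *: (x : Z).

HB.instance Definition _ := GRing.Zmodule.copy (realified iota Z) Z.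

Fact realified_scaleA a b x : scale a (scale b x) = scale (a * b) x.
Proof. by rewrite /scale scalerA rmorphM. Qed.
Fact realified_scale1 : left_id 1 scale.
Proof. by move=> x; rewrite /scale rmorph1 scale1r. Qed.
Fact realified_scaleDr : right_distributive scale +%R.
Proof. by move=> a x y; rewrite /scale scalerDr. Qed.
Fact realified_scaleDl x : {morph scale^~ x : a b / a + b}.
Proof. by move=> a b; rewrite /scale rmorphD scalerDl. Qed.

HB.instance Definition _ := GRing.Zmodule_isLmodule.Build R (realified iota Z)
  realified_scaleA realified_scale1 realified_scaleDr realified_scaleDl.

Lemma realified_scaleE (a : R) (x : realified iota Z) : a *: x = iota a *: (x : Z).
Proof. by []. Qed.

End Realified.

Section RealForm.
Context {R : realType} {K : numFieldType} {iota : {rmorphism R -> K}} {re : K -> R}.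
Hypothesis rf : real_form iota re.

Lemma rf_lt a b : (iota a < iota b) = (a < b).
Proof. by rewrite !lt_def !(rf_le rf)// fmorph_eq. Qed.

Lemma rf_iota_ge0 a : (0 <= iota a) = (0 <= a).
Proof. by rewrite -{1}(rmorph0 iota) (rf_le rf). Qed.

Lemma rf_iota_gt0 a : (0 < iota a) = (0 < a).
Proof. by rewrite -{1}(rmorph0 iota) rf_lt. Qed.

Lemma rf_reK a : re (iota a) = a.
Proof. by rewrite -[iota a]mulr1 (rf_reZ rf) (rf_re1 rf) mulr1. Qed.

Lemma rf_re_gt0 k : 0 < k -> 0 < re k.
Proof. by move=> k0; rewrite -rf_lt rmorph0 (rf_ge0 rf)// ltW. Qed.

Lemma rf_norm a : `|iota a| = iota `|a|.
Proof.
have [a0|a0] := leP 0 a; first by rewrite ger0_norm ?rf_iota_ge0// ger0_norm.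
rewrite [in RHS]ltr0_norm// -[in LHS](opprK a) rmorphN normrN.
by rewrite ger0_norm ?rf_iota_ge0 ?oppr_ge0 ?ltW.
Qed.

Definition real_norm (Z : normedModType K) (x : Z) : R := re `|x|.

Lemma iota_rnorm (Z : normedModType K) (x : Z) : iota (real_norm x) = `|x|.
Proof. exact: (rf_ge0 rf). Qed.

Lemma rnorm_le (Z W : normedModType K) (x : Z) (y : W) :
  (`|x| <= `|y|) = (real_norm x <= real_norm y).
Proof. by rewrite -!iota_rnorm (rf_le rf). Qed.

Lemma rnorm_seminorm (Z : normedModType K) :
  seminorm (fun x : realified iota Z => real_norm (x : Z)).
Proof.
split=> [x y|a x].
  by rewrite -(rf_le rf) rmorphD !iota_rnorm ler_normD.
by rewrite /real_norm realified_scaleE normrZ rf_norm (rf_reZ rf).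
Qed.

Lemma rnorm_complete (Z : completeNormedModType K) :
  seminorm_complete (fun x : realified iota Z => real_norm (x : Z)).
Proof.
move=> u cu; have /cauchy_cvg/cvg_ex[l ul] : cauchy ((u : nat -> Z) @ \oo).
  apply: cauchy_exP => e e0; have re0 := rf_re_gt0 e0.
  have [n0 un0] := cu (re e / 2) (divr_gt0 re0 (ltr0Sn _ 1)).
  exists (u n0); exists n0 => // n /= n0n; rewrite -ball_normE/=.
  rewrite -(rf_ge0 rf (ltW e0)) -iota_rnorm rf_lt.
  by apply: le_lt_trans (un0 _ _ (leqnn _) n0n) _; lra.
exists l => e e0; move/cvgrPdist_lt: ul => /(_ (iota e)).
rewrite rf_iota_gt0 => /(_ e0)[n0 _ hn0]; exists n0 => n n0n.
have := hn0 n n0n; rewrite /= -normrN opprB -iota_rnorm rf_lt => /ltW.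
exact.
Qed.

Lemma rnorm_dentable (Z : normedModType K) : RNP Z ->
  dentable_sets (fun x : realified iota Z => real_norm (x : Z)).
Proof.
move=> rZ A M delta A0 AM delta0.
have [||a Aa] := rZ A A0 _ (iota delta).
- exists (iota M); split=> [|r Mr x Ax /=].
    by rewrite realE -(rmorph0 iota) !(rf_le rf) le_total.
  apply: le_trans (ltW Mr); rewrite -iota_rnorm (rf_le rf); exact: AM.
- by rewrite rf_iota_gt0.
rewrite /closed_convex_hull; set hull := smallest _ _ => nhull.
(* Without a gap the hull would meet every ball around [a], putting [a] in its closure. *)
have [gamma [gamma0 hg]] : exists gamma : R, 0 < gamma /\
    forall x : Z, hull x -> gamma <= real_norm (a - x).
  apply: contrapT => /forallNP hn; apply: nhull => B /nbhs_ballP[e /= e0 eB].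
  have := hn (re e) => /not_andP[/(_ (rf_re_gt0 e0))//|].
  move=> /existsNP[x /not_implyP[hx /negP]]; rewrite -ltNge => ax.
  exists x; split=> //; apply: eB; rewrite -ball_normE/=.
  by rewrite -(rf_ge0 rf (ltW e0)) -iota_rnorm rf_lt.
exists a, hull, gamma; split=> //.
- move=> x y t /andP[t0 t1] hx hy S [cS AS].
  have k0 : 0 <= iota t by rewrite rf_iota_ge0.
  have k1 : iota t <= 1 by rewrite -(rmorph1 iota) (rf_le rf).
  have := cS x y (Itv01 k0 k1); rewrite !inE.
  move=> /(_ (hx S (conj cS AS)) (hy S (conj cS AS))).
  by rewrite /conv/= !realified_scaleE rmorphB rmorph1.
- move=> b Ab ab S [cS]; apply; split=> // /=.
  by rewrite -iota_rnorm rf_lt ltNge ab.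
Qed.

End RealForm.

(** * Perturbing an operator *)

Section RealForm.
Context {R : realType} {K : numFieldType} {iota : {rmorphism R -> K}} {re : K -> R}.
Hypothesis rf : real_form iota re.
Local Notation rnorm := (@real_norm R K re _).

Lemma closure_rnorm (Z : normedModType K) (A : set Z) (u : Z) :
  (forall e : R, 0 < e -> exists2 x, A x & rnorm (u - x) <= e) -> closure A u.
Proof.
move=> Au B /nbhs_ballP[e /= e0 eB].
have re0 := rf_re_gt0 rf e0.
have [|x Ax ux] := Au (re e / 2); first by rewrite divr_gt0.
exists x; split=> //; apply: eB; rewrite -ball_normE/=.
rewrite -(rf_ge0 rf (ltW e0)) -(iota_rnorm rf) (rf_lt rf).
by apply: le_lt_trans ux _; lra.
Qed.

Lemma closure_norm_le (Z : normedModType K) (A : set Z) (u : Z) (k : K) :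
  closure A u -> (forall x, A x -> `|x| <= k) -> `|u| <= k.
Proof.
move=> Au Ak; have [x [Ax _]] := Au setT filterT.
have k0 : 0 <= k by apply: le_trans (Ak _ Ax).
rewrite -(rf_ge0 rf k0) -(iota_rnorm rf) (rf_le rf).
apply/ler_addgt0Pr => e e0.
have [|y [Ay]] := Au (ball u (iota e)).
  by apply: nbhsx_ballx; rewrite (rf_iota_gt0 rf).
rewrite -ball_normE/= -(iota_rnorm rf) (rf_lt rf) => uy.
have : rnorm u <= rnorm (u - y) + rnorm y.
  by rewrite -(rf_le rf) rmorphD !(iota_rnorm rf) -{1}(subrK y u) ler_normD.
have : rnorm y <= re k.
  by rewrite -(rf_le rf) (iota_rnorm rf) (rf_ge0 rf)//; exact: Ak.
lra.
Qed.

(** [supremum] chooses among the least upper bounds. As [u] is in the closure, [|u|] is one of them,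
    and they are unique. *)
Lemma op_norm_attained (X Y : normedModType K) (T : X -> Y) (u : Y) :
  closure (T @` @closed_unit_ball K X) u ->
  (forall x, `|x| <= 1 -> `|T x| <= `|u|) -> `|u| = op_norm T.
Proof.
move=> Tu uT; rewrite /op_norm /supremum.
set E := [set `|T x| | x in _].
have E0 : E !=set0 by exists `|T 0|, 0 => //; rewrite /closed_unit_ball/= normr0.
rewrite ifF; last by apply/negbTE/set0P.
have supu : supremums E `|u|.
  split=> [_ [x x1 <-]|k kE]; first exact: uT.
  by apply: closure_norm_le Tu _ => _ [x x1 <-]; apply: kE; exists x.
by case: xgetP => [k _ supk|/(_ `|u|)//]; exact: is_subset1_supremums supu supk.
Qed.

Lemma op_norm_lt (X Y : normedModType K) (T : X -> Y) (k eps : K) :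
  (forall x, `|x| <= 1 -> `|T x| <= k) -> k < eps -> 0 < eps -> op_norm T < eps.
Proof.
(* If no least upper bound exists, [supremum] takes its default value [0], which is below [eps]. *)
move=> Tk keps eps0; rewrite /op_norm /supremum; case: ifPn => // _.
case: xgetP => [m _ [_ mlub]|//].
by apply: le_lt_trans keps; apply: mlub => _ [x x1 <-]; exact: Tk.
Qed.

Lemma continuous_rnorm (X Y : normedModType K) (T : {linear X -> Y}) :
  continuous T -> exists2 C : R, 0 <= C & forall x, rnorm (T x) <= C * rnorm x.
Proof.
move=> /linear_bounded_continuous/linear_boundedP/pinfty_ex_gt0[r r0 rT].
exists (re r); first exact/ltW/(rf_re_gt0 rf).
move=> x; rewrite -(rf_le rf) rmorphM !(iota_rnorm rf) (rf_ge0 rf (ltW r0)).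
exact: rT.
Qed.

Lemma rnorm_continuous (X Y : normedModType K) (T : {linear X -> Y}) (C : R) :
  (forall x, rnorm (T x) <= C * rnorm x) -> continuous T.
Proof.
move=> TC; apply/linear_bounded_continuous/linear_boundedP.
exists (iota C); split; first by rewrite realE -(rmorph0 iota) !(rf_le rf) le_total.
move=> r Cr x; apply: (@le_trans _ _ (iota C * `|x|)).
  by rewrite -!(iota_rnorm rf) -rmorphM (rf_le rf).
by rewrite ler_wpM2r// ltW.
Qed.

Lemma unit_rotation (k : K) : exists2 t : K, `|t| = 1 & t * k = `|k|.
Proof.
have [->|k0] := eqVneq k 0; first by exists 1; rewrite ?normr1// mulr0 normr0.
exists (`|k| / k); last by rewrite divfK.
by rewrite normrM normfV normr_id divff// normr_eq0.
Qed.

Lemma QNA_approx (X Y Z : completeNormedModType K) (P : {linear X -> Z})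
  (Q : {linear Z -> Y}) (T : {linear X -> Y}) (eps : K) :
  continuous P -> continuous Q -> continuous T -> (forall x, T x = Q (P x)) ->
  RNP Z -> 0 < eps -> exists2 S, QNA X Y S & op_norm (S \- T) < eps.
Proof.
move=> cP cQ cT TE rZ eps0.
(* The zero operator attains its norm; otherwise [T x0] supplies a unit vector of [Y] for the case
   [Q b' = 0]. *)
have [T0|] := pselect (forall x, T x = 0).
  exists T.
    split=> //; exists 0; last first.
      apply: op_norm_attained => [|x _]; last by rewrite T0.
      by apply: subset_closure; exists 0; rewrite ?T0// /closed_unit_ball/= normr0.
    by apply: subset_closure; exists 0; rewrite ?T0// /closed_unit_ball/= normr0.
  by apply: (op_norm_lt (k := 0)) => // x _; rewrite /= subrr normr0.
move=> /existsNP[x0 /eqP Tx0].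
have [CP CP0 PC] := continuous_rnorm cP; have [CQ CQ0 QC] := continuous_rnorm cQ.
have sZ := rnorm_seminorm rf Z; have sY := rnorm_seminorm rf Y.
pose D := [set z : Z | forall e : R, 0 < e ->
  exists2 x, `|x| <= 1 & rnorm (P x - z) <= e].
have PD x : `|x| <= 1 -> D (P x).
  move=> x1 e e0; exists x => //.
  by rewrite subrr /real_norm normr0 -(rmorph0 iota) (rf_reK rf) ltW.
have PB x : `|x| <= 1 -> rnorm (P x) <= CP.
  move=> x1; apply: le_trans (PC x) _; rewrite ler_piMr//.
  by rewrite -(rf_le rf) (iota_rnorm rf) rmorph1.
have CP1 : 0 < CP + 1 by rewrite ltr_wpDl.
(* The perturbation of [T] will have norm at most [r * CP], hence below [eps]. *)
pose r := re eps / (CP + 1); have r0 : 0 < r by rewrite divr_gt0// (rf_re_gt0 rf).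
have DM z : D z -> rnorm z <= CP + 1.
  move=> /(_ 1 ltr01)[x x1 xz]; rewrite -[z](subKr (P x)).
  apply: le_trans (sZ.1 (P x) (- (P x - z))) _.
  by rewrite (seminormN sZ) lerD// PB.
have D_closed b : (forall e : R, 0 < e -> exists2 z, D z & rnorm (z - b) <= e) -> D b.
  move=> Db e e0; have e2 : 0 < e / 2 by rewrite divr_gt0.
  have [z Dz zb] := Db _ e2; have [x x1 xz] := Dz _ e2; exists x => //.
  by apply: le_trans (seminorm_trans sZ z _ _) _; rewrite [e]splitr lerD.
have D0 : D !=set0 by exists (P 0); apply: PD; rewrite normr0.
have fc z : D z -> rnorm (Q z) <= CQ * (CP + 1).
  by move=> /DM zM; apply: le_trans (QC z) _; rewrite ler_wpM2l.
have lf : lip (fun z : realified iota Z => rnorm (z : Z)) CQ (fun z => rnorm (Q z)).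
  split=> // y z; rewrite -{1}[y : Z](subrKC z) linearD.
  by apply: le_trans (sY.1 _ _) _; rewrite lerD2l QC.
have [l [b [[/scalar_funP[lD lZ] lr] Db bmax]]] :=
  stegall sZ (rnorm_complete rf (Z := Z)) (rnorm_dentable rf rZ) D0 fc DM r0 D_closed lf.
have [L /scalar_funP[LD LZ] Ll] := rf_lift rf lD lZ.
have rot (W : normedModType K) (t : K) (z : W) : `|t| = 1 -> rnorm (t *: z) = rnorm z.
  by move=> t1; rewrite /real_norm normrZ t1 mul1r.
(* Rotating [z] makes [L z] real and nonnegative, which turns bounds on the real part [l] into
   bounds on the modulus of [L]. *)
have Lrot (z : Z) : exists2 t : K, `|t| = 1 & l (t *: z : Z) = re `|L z|.
  by have [t t1 tL] := unit_rotation (L z); exists t; rewrite // -Ll LZ tL.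
have LB y z : L (y - z) = L y - L z by rewrite LD -scaleN1r LZ mulN1r.
have Lr (z : Z) : re `|L z| <= r * rnorm z.
  by have [t t1 <-] := Lrot z; rewrite -(rot _ t z t1); exact: lr.
have Drot (t : K) (z : Z) : `|t| = 1 -> D z -> D (t *: z).
  move=> t1 Dz e /Dz[x x1 xz]; exists (t *: x); first by rewrite normrZ t1 mul1r.
  by rewrite linearZ -scalerBr rot.
have Dmax (z : Z) : D z -> rnorm (Q z) + re `|L z| <= rnorm (Q b) + re `|L b|.
  move=> Dz; have [t t1 <-] := Lrot z.
  have := bmax _ (Drot t z t1 Dz); rewrite linearZ (rot _ _ _ t1).
  move/le_trans; apply; rewrite lerD2l -Ll; exact: rf_re_norm rf _.
(* With [L b'] nonnegative, [Q b'] and [L b' *: w] point the same way, so their norms add up in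
   [u]. *)
have [b' [Db' Lb' b'max]] : exists b' : Z, [/\ D b', L b' = `|L b'| &
    forall z, D z -> rnorm (Q z) + re `|L z| <= rnorm (Q b') + re `|L b'|].
  have [t t1 tL] := unit_rotation (L b); exists (t *: b).
  by rewrite LZ tL normr_id linearZ rot//; split=> //; exact: Drot.
have [w w1 Qw] : exists2 w : Y, `|w| = 1 & Q b' = `|Q b'| *: w.
  have unit (y : Y) : y != 0 -> `| `|y|^-1 *: y| = 1.
    by move=> y0; rewrite normrZ normfV normr_id mulVf// normr_eq0.
  have [Q0|Q0] := eqVneq (Q b') 0.
    by exists (`|T x0|^-1 *: T x0); rewrite ?unit// Q0 normr0 scale0r.
  by exists (`|Q b'|^-1 *: Q b'); rewrite ?unit// scalerA divff ?scale1r ?normr_eq0.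
have Slin : linear (fun x => T x + L (P x) *: w).
  move=> a x y; rewrite !linearP LD LZ scalerDl -scalerA scalerDr.
  by rewrite addrACA.
pose S : {linear X -> Y} := HB.pack (fun x => T x + L (P x) *: w)
  (GRing.isLinear.Build K X Y *:%R _ Slin).
have SE x : S x = T x + L (P x) *: w by [].
pose u := Q b' + L b' *: w.
have nLw z : rnorm (L z *: w) = re `|L z| by rewrite /real_norm normrZ w1 mulr1.
have uE : rnorm u = rnorm (Q b') + re `|L b'|.
  rewrite /real_norm /u {1}Qw {1}Lb' -scalerDl normrZ w1 mulr1 ger0_norm ?addr_ge0//.
  rewrite -{1}(iota_rnorm rf) -{1}(rf_ge0 rf (normr_ge0 (L b'))) -rmorphD.
  by rewrite (rf_reK rf).
have Su x : `|x| <= 1 -> `|S x| <= `|u|.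
  move=> x1; rewrite (rnorm_le rf) SE TE uE.
  apply: le_trans (sY.1 _ _) _; rewrite nLw; exact/b'max/PD.
have clu : closure (S @` @closed_unit_ball K X) u.
  apply: closure_rnorm => e e0.
  have C1 : 0 < CQ + r by rewrite ltr_wpDl.
  have [x x1 xb] := Db' _ (divr_gt0 e0 C1); exists (S x); first by exists x.
  have -> : u - S x = - (Q (P x - b') + L (P x - b') *: w).
    rewrite SE TE /u linearB LB scalerBl.
    by rewrite [in RHS]addrACA -opprD opprB.
  rewrite (seminormN sY); apply: le_trans (sY.1 _ _) _; rewrite nLw.
  apply: le_trans (lerD (QC _) (Lr _)) _.
  by rewrite -mulrDl mulrC -ler_pdivlMr.
exists S.
  split; last by exists u => //; exact: op_norm_attained.
  have [CT CT0 TC] := continuous_rnorm cT.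
  apply: (@rnorm_continuous _ _ _ (CT + r * CP)) => x; rewrite SE mulrDl.
  apply: le_trans (sY.1 _ _) _; rewrite nLw lerD// -mulrA.
  by apply: le_trans (Lr _) _; rewrite ler_wpM2l// ltW.
apply: (op_norm_lt (k := iota (r * CP))) => // [x x1|].
  rewrite /= addrC addKr -(iota_rnorm rf) (rf_le rf) nLw.
  by apply: le_trans (Lr _) _; rewrite ler_wpM2l ?PB// ltW.
rewrite -(rf_ge0 rf (ltW eps0)) (rf_lt rf) /r mulrAC ltr_pdivrMr//.
by rewrite ltr_pM2l ?(rf_re_gt0 rf)// ltrDl.
Qed.

End RealForm.

Lemma QNA_dense (R : realType) (K : numFieldType) (iota : {rmorphism R -> K})
    (re : K -> R) (X Y : completeNormedModType K) : real_form iota re ->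
  RNP X \/ RNP Y -> dense_in_bounded_op (QNA X Y).
Proof.
move=> rf rXY T eps cT eps0.
have cid0 (Z : completeNormedModType K) : continuous (idfun : Z -> Z).
  by move=> x; exact: cvg_id.
(* [T] is factored through the space with the RNP, the other factor being the identity. *)
case: rXY => [rX|rY].
- by apply: (@QNA_approx R K iota re rf X Y X idfun T T) => //; exact: cid0.
- by apply: (@QNA_approx R K iota re rf X Y Y T idfun T) => //; exact: cid0.
Qed.

Lemma real_form_real (R : realType) : real_form (idfun : {rmorphism R -> R}) id.
Proof.
by split=> // [k|Z l lD lZ]; [exact: ler_norm|exists l => //; apply/scalar_funP].
Qed.

Lemma real_form_complex (R : realType) :
  real_form (real_complex R : {rmorphism R -> complex R}) (@complex.Re R).
Proof.
split=> [a b|a [x y]||[x y]|k|Z l lD lZ] //=.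
- by rewrite lecR.
- by rewrite mul0r subr0.
- by rewrite lecE /= => /andP[/eqP-> _].
- by rewrite -lecR; apply: le_trans (normc_ge_Re k); rewrite lecR ler_norm.
(* This is the usual complexification, sending [x] to [l x - i l (i x)]. *)
- exists (fun x => (l x +i* - l ('i%C *: x))%C) => // k x y.
  have lN (z : Z) : l (- z) = - l z.
    by rewrite -scaleN1r -(rmorph1 (real_complex R)) -rmorphN lZ mulN1r.
  have lC (z : Z) : l (k *: z) = complex.Re k * l z + complex.Im k * l ('i%C *: z).
    by rewrite [k in LHS]complexE scalerDl lD lZ ['i%C * _]mulrC -scalerA lZ.
  have lCi : l ('i%C *: (k *: x)) =
      complex.Re k * l ('i%C *: x) - complex.Im k * l x.
    rewrite scalerA mulrC -scalerA lC scalerA -expr2 sqr_i scaleN1r.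
    by rewrite lN mulrN.
  rewrite lD lC scalerDr lD lCi; case: k {lC lCi} => a b /=.
  by congr (_ +i* _)%C; ring.
Qed.

Theorem corollary3p5 (R : realType) :
  (forall X Y : completeNormedModType R,
     RNP X \/ RNP Y -> dense_in_bounded_op (QNA X Y)) /\
  (forall X Y : completeNormedModType (complex R),
     RNP X \/ RNP Y -> dense_in_bounded_op (QNA X Y)).
Proof.
split=> X Y; apply: QNA_dense; [exact: real_form_real|exact: real_form_complex].
Qed.
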